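(* For $x\in\mathbb{R}$ define the integer sequence $(x_0,x_1,\dots)$ as follows: $r_0x=x$; recursively, given $r_kx$, let $x_k$ be the unique integer with $1\ge x_k-r_kx>0$, and set $r_{k+1}x=\frac{1}{x_k-r_kx}$. Then for all $x,y\in\mathbb{R}$ we have $x<y$ if and only if there exists $N\ge0$ such that $x_N<y_N$ and $x_n=y_n$ for all $n<N$ (i.e. the sequence of $x$ precedes that of $y$ in the lexicographic order).
   Context: The sequence $(x_0,x_1,\dots)$ is the subtraction continued fraction of $x$; it satisfies $x_n\ge2$ for $n\ge1$. *)

(* Defs.v *)
From mathcomp Require Import all_boot all_order all_algebra.
From mathcomp Require Import reals.
Set Implicit Arguments.
Unset Strict Implicit.
Unset Printing Implicit Defensive.
Import Order.TTheory GRing.Theory Num.Theory.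
Local Open Scope ring_scope.

Lemma next_int_exists (R : realType) (r : R) :
  exists m : int, 0 < m%:~R - r <= 1.
Proof.
exists (Num.floor r + 1).
by rewrite subr_gt0 floorD1_gt intrD addrAC gerDr subr_le0 floor_le.
Qed.

(* [m] is determined by this condition, see [next_int_unique], so that [xchoose]
   picks out the unique such integer. *)
Definition next_int (R : realType) (r : R) : int := xchoose (next_int_exists r).

Lemma next_intP (R : realType) (r : R) : 0 < (next_int r)%:~R - r <= 1.
Proof. exact: xchooseP (next_int_exists r). Qed.

Lemma next_int_unique (R : realType) (r : R) (m : int) :
  0 < m%:~R - r <= 1 -> m = next_int r.
Proof.
have aux (a : int) : 0 < a%:~R - r <= 1 -> Num.floor r = a - 1.
  move=> /andP[h0 h1]; apply: floor_def; rewrite subrK intrB.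
  by rewrite -subr_gt0 h0 andbT lerBlDr addrC -lerBlDr.
move=> /aux hm; have := aux _ (next_intP r).
by rewrite hm => /addIr.
Qed.

Definition subcf_step (R : realType) (r : R) : R := 1 / ((next_int r)%:~R - r).

(* [subcf_rem k x] is r_k x. *)
Definition subcf_rem (R : realType) (k : nat) (x : R) : R :=
  iter k (@subcf_step R) x.

(* [subcf x k] is the term x_k of the subtraction continued fraction of x. *)
Definition subcf (R : realType) (x : R) (k : nat) : int :=
  next_int (subcf_rem k x).

(* Main.v *)
(* On each fibre of [next_int] the step map [r |-> 1 / (m - r)] is increasing,
   and [next_int] itself is nondecreasing, so at the first index where the
   expansions differ the terms compare as [x] and [y] do.  Some index differs:
   if [x < y] and all terms agree, the gap [d] between the remainders is
   multiplied at each step by the product of the two new remainders, which is at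
   least [1 + d]; the gap then tends to infinity, although two reals with
   the same [next_int] are less than [1] apart. *)

Require Import Defs.
From mathcomp Require Import all_boot all_order all_algebra.
From mathcomp Require Import boolp reals.
From mathcomp Require Import ring lra.
Import Order.TTheory GRing.Theory Num.Theory.
Local Open Scope ring_scope.

Lemma next_int_floor (R : realType) (r : R) : next_int r = Num.floor r + 1.
Proof.
apply/esym/next_int_unique.
by rewrite subr_gt0 floorD1_gt intrD addrAC gerDr subr_le0 floor_le.
Qed.

Lemma le_next_int (R : realType) (r s : R) : r <= s -> next_int r <= next_int s.
Proof. by move=> rs; rewrite !next_int_floor lerD2r le_floor. Qed.

Lemma subcf_step_ge1 (R : realType) (r : R) : 1 <= subcf_step r.
Proof.
have /andP[d0 d1] := next_intP r.
by rewrite /subcf_step ler_pdivlMr // mul1r.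
Qed.

Lemma subcf_step_sub (R : realType) (r s : R) : next_int r = next_int s ->
  subcf_step s - subcf_step r = (s - r) * (subcf_step s * subcf_step r).
Proof.
move=> rs; have /andP[r0 _] := next_intP r; have /andP[s0 _] := next_intP s.
rewrite /subcf_step -rs in s0 *.
by field; rewrite !gt_eqF.
Qed.

Lemma ltr_subcf_step (R : realType) (r s : R) : next_int r = next_int s ->
  (subcf_step r < subcf_step s) = (r < s).
Proof.
move=> rs; rewrite -subr_gt0 subcf_step_sub // pmulr_lgt0 ?subr_gt0 //.
by rewrite mulr_gt0 // (lt_le_trans ltr01) // subcf_step_ge1.
Qed.

(** Each step preserves and reflects order on a fibre of [next_int]. The boolean equality carries
    the order both to index [N] and back. *)
Lemma ltr_subcf_rem (R : realType) (x y : R) (N : nat) :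
  (forall n, (n < N)%N -> subcf x n = subcf y n) ->
  (subcf_rem N x < subcf_rem N y) = (x < y).
Proof.
elim: N => [//|N IH] xy; rewrite [LHS]ltr_subcf_step; last exact: xy.
by apply: IH => n nN; apply/xy/ltnW.
Qed.

(** New remainders are at least 1, so the gap does not shrink; hence [subcf_step s], and with it the
    multiplying product, is at least [1 + (s - r)]. *)
Lemma subcf_step_gap (R : realType) (r s : R) :
  next_int r = next_int s -> r < s ->
  (s - r) + (s - r) ^+ 2 <= subcf_step s - subcf_step r.
Proof.
move=> rs lt_rs; have := subcf_step_sub _ _ _ rs.
have := subcf_step_ge1 _ r; have : subcf_step r < subcf_step s.
  by rewrite ltr_subcf_step.
move: (subcf_step r) (subcf_step s) => a b ab a1 gap.
have b1 : 1 <= b by apply: le_trans (ltW ab).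
have d0 : 0 < s - r by rewrite subr_gt0.
have le_gap : s - r <= b - a by rewrite gap ler_peMr ?mulr_ege1 ?(ltW d0).
rewrite gap expr2 -[X in X + _]mulr1 -mulrDr ler_pM2l //.
have : b <= b * a by rewrite ler_peMr // (le_trans ler01).
lra.
Qed.

(** The gap never drops below [y - x], so each step adds at least [(y - x) ^+ 2]. *)
Lemma subcf_rem_gap (R : realType) (x y : R) (n : nat) :
  x < y -> (forall k, subcf x k = subcf y k) ->
  (y - x) + (y - x) ^+ 2 *+ n <= subcf_rem n y - subcf_rem n x.
Proof.
move=> lt_xy xy; elim: n => [|n IH]; first by rewrite addr0.
have lt_n : subcf_rem n x < subcf_rem n y by rewrite ltr_subcf_rem.
apply: le_trans (subcf_step_gap _ _ _ (xy n) lt_n).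
rewrite mulrSr addrA lerD // lerXn2r ?nnegrE ?subr_ge0 ?(ltW lt_xy) ?(ltW lt_n) //.
by apply: le_trans IH; rewrite lerDl mulrn_wge0 // sqr_ge0.
Qed.

Lemma exists_subcf_neq (R : realType) (x y : R) :
  x < y -> exists n, subcf x n != subcf y n.
Proof.
move=> lt_xy; apply: contrapT => /forallNP eq_xy.
have xy k : subcf x k = subcf y k by have /negP/negPn/eqP := eq_xy k.
have d0 : 0 < y - x by rewrite subr_gt0.
set n := Num.bound ((y - x) ^+ 2)^-1.
have n_gt : 1 < (y - x) ^+ 2 *+ n.
  rewrite -mulr_natl -ltr_pdivrMr ?exprn_gt0 // div1r.
  by apply: archi_boundP; rewrite invr_ge0 sqr_ge0.
have := subcf_rem_gap _ x y n lt_xy xy.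
(* With [m] the common [n]-th term, both remainders lie in [[m - 1, m)], so their gap is below 1. *)
have /andP[_ hx] := next_intP (subcf_rem n x).
have /andP[hy _] := next_intP (subcf_rem n y).
have := xy n; rewrite /subcf => xyn; rewrite xyn in hx.
lra.
Qed.

Theorem theorem3 (R : realType) (x y : R) :
  x < y <->
  exists N : nat, subcf x N < subcf y N /\
    forall n : nat, (n < N)%N -> subcf x n = subcf y n.
Proof.
split=> [lt_xy|[N [lt_N eq_lt]]]; last first.
  (* Remainders in the opposite order at [N] would contradict [lt_N], as [next_int] is
     nondecreasing. *)
  rewrite -(ltr_subcf_rem _ _ _ _ eq_lt) ltNge; apply/negP => /le_next_int.
  by rewrite leNgt => /negP; apply.
case: (ex_minnP (exists_subcf_neq _ _ _ lt_xy)) => N neq_N min_N.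
have eq_lt n : (n < N)%N -> subcf x n = subcf y n.
  by move=> nN; apply/eqP/contraT => /min_N; rewrite leqNgt nN.
exists N; split=> //; rewrite lt_neqAle neq_N /=.
by apply/le_next_int/ltW; rewrite ltr_subcf_rem.
Qed.
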